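(* Let $T:\mathbb{R}^n\to \mathcal{P}(\mathbb{R}^n)$ be a multivalued map that is $h$-monotone. Then $T(x)$ is a singleton for all points $x\in \mathrm{dom}(T)$ except on a set of (Lebesgue) measure zero; that is, the set $\{x\in \mathrm{dom}(T): T(x)\text{ is not a singleton}\}$ has Lebesgue measure zero.
   Context: Standing assumptions on the cost: $h\in C^2(\mathbb{R}^n)$ is real-valued, nonnegative, and positively homogeneous of degree $p$ for some real $p\ge 2$ (i.e. $h(tx)=t^p h(x)$ for $t>0$), and its Hessian $D^2h(x)$ is positive definite for each $x$ in the unit sphere $S^{n-1}$; equivalently there are constants $\lambda,\Lambda>0$ such that $\lambda|v|^2\le \langle D^2h(x)v,v\rangle\le \Lambda|v|^2$ for all $x\in S^{n-1}$, $v\in\mathbb{R}^n$. $\mathcal{P}(\mathbb{R}^n)$ is the set of all subsets of $\mathbb{R}^n$ (so $T(x)$ may be empty). The domain of $T$ is $\mathrm{dom}(T)=\{x\in\mathbb{R}^n: T(x)\neq\emptyset\}$. The map $T$ is $h$-monotone if $$h(x-\xi)+h(y-\zeta)\le h(x-\zeta)+h(y-\xi)$$ for all $x,y\in\mathrm{dom}(T)$, all $\xi\in T(x)$ and all $\zeta\in T(y)$. *)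

(* Defs.v *)
From mathcomp Require Import all_boot all_order all_algebra.
From mathcomp Require Import all_classical all_reals all_analysis.

Set Implicit Arguments.
Unset Strict Implicit.
Unset Printing Implicit Defensive.

Import Order.TTheory GRing.Theory Num.Theory.
Import numFieldNormedType.Exports.

Local Open Scope classical_set_scope.
Local Open Scope ring_scope.

Section Defs.
Context {R : realType} {n : nat}.
Implicit Types (x u v a b : 'rV[R]_n) (f h : 'rV[R]_n -> R).

Definition dotp u v : R := \sum_(i < n) u 0 i * v 0 i.

(* The library norm on 'rV[R]_n is the sup norm, so the Euclidean sphere has to
   be written with the inner product. *)
Definition unit_sphere : set 'rV[R]_n := [set x | dotp x x = 1].

Definition basis_vec (i : 'I_n) : 'rV[R]_n := delta_mx 0 i.

Definition partial (i : 'I_n) f : 'rV[R]_n -> R := fun x => 'D_(basis_vec i) f x.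

(* The derivability clause is needed because 'D_v f x is a total operator with
   a junk value where the directional derivative does not exist. *)
Fixpoint Ck (k : nat) f : Prop :=
  match k with
  | 0%N => continuous f
  | k'.+1 => continuous f /\
      forall i : 'I_n,
        (forall x, derivable f x (basis_vec i)) /\ Ck k' (partial i f)
  end.

Definition hessian f x : 'M[R]_n :=
  \matrix_(i < n, j < n) partial i (partial j f) x.

(* Vectors are rows, so M acts on v as the row (M *m v^T)^T. *)
Definition pos_def (M : 'M[R]_n) : Prop :=
  forall v, v != 0 -> 0 < dotp (M *m v^T)^T v.

Definition pos_homogeneous (p : R) h : Prop :=
  forall (t : R) x, 0 < t -> h (t *: x) = t `^ p * h x.

Definition dom (T : 'rV[R]_n -> set 'rV[R]_n) : set 'rV[R]_n :=
  [set x | T x !=set0].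

Definition h_monotone h (T : 'rV[R]_n -> set 'rV[R]_n) : Prop :=
  forall x y, dom T x -> dom T y ->
  forall xi zeta, T x xi -> T y zeta ->
    h (x - xi) + h (y - zeta) <= h (x - zeta) + h (y - xi).

Definition is_singleton (A : set 'rV[R]_n) : Prop := exists y, A = [set y].

Definition box a b : set 'rV[R]_n :=
  [set x | forall i : 'I_n, a 0 i <= x 0 i <= b 0 i].

Definition box_volume a b : R := \prod_(i < n) (b 0 i - a 0 i).

(* n-dimensional Lebesgue outer measure, for 0 < n (for n = 0 every box has
   volume 1). The bound a k <= b k makes box_volume the actual volume of the
   box. Lebesgue measure is the restriction of this outer measure to its
   Caratheodory measurable sets, which include every set of outer measure 0;
   hence a set is Lebesgue null iff its outer measure is 0. *)
Definition lebesgue_outer (A : set 'rV[R]_n) : \bar R :=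
  ereal_inf [set V : \bar R | exists a b : nat -> 'rV[R]_n,
    [/\ forall (k : nat) (i : 'I_n), a k 0 i <= b k 0 i,
        A `<=` \bigcup_k box (a k) (b k)
      & V = (\sum_(0 <= k <oo) (box_volume (a k) (b k))%:E)%E ]].

End Defs.

(* Main.v *)
Require Import Defs.
From mathcomp Require Import all_boot all_order all_algebra.
From mathcomp Require Import all_classical all_reals all_analysis.
From mathcomp Require Import ring lra.
Import Order.TTheory GRing.Theory Num.Theory.
Import numFieldNormedType.Exports.
Local Open Scope classical_set_scope.
Local Open Scope ring_scope.

(** At a point x0 where T takes two values xi0 <> zeta0, put
    w = Dh (x0 - xi0) - Dh (x0 - zeta0). The gradient Dh is injective
    ([gradient_injective]), so w <> 0. Indeed Dh (t x) = t^(p-1) Dh x for t > 0,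
    so the Hessian is homogeneous too and its positivity spreads from the
    sphere to every nonzero point ([hessian_pos_def]); along a nondegenerate
    segment, which meets the origin at most once, the slope of h is therefore
    strictly increasing.

    Take x and y close to x0, xi in T x close to xi0 and zeta in T y close to
    zeta0. Written as
      h (x - xi) - h (y - xi) <= h (x - zeta) - h (y - zeta),
    h-monotonicity gives <w, x - y> <= eps |x - y|, because Dh is continuous.
    If T takes values near both xi0 and zeta0 at both points, x and y can be
    exchanged, so |<w, x - y>| <= eps |x - y|: such points lie on a Lipschitz
    graph in the direction of the largest coordinate of w
    ([two_valued_lipschitz_graph]).

    A bounded piece of a Lipschitz graph is covered by about N^(n-1) boxes of
    volume of order N^(-n), so it is null ([outer_null_lipschitz_graph]).
    Choosing rational centres and radii 1/(k+1) shows that countably many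
    pieces suffice ([outer_null_multivalued]). *)

(** * Null sets *)

Section NullSets.
Context {R : realType} {n : nat}.
Implicit Types (A B : set 'rV[R]_n) (a b x y : 'rV[R]_n).

(** The open sup-norm ball, in coordinates, since all estimates below are made
    one coordinate at a time. *)
Definition cube x (r : R) : set 'rV[R]_n :=
  [set y | forall i : 'I_n, `|y 0 i - x 0 i| < r].

(** Bounding all finite partial sums in [R] expresses the bound on the extended
    real series while keeping the volume estimates inside a field. *)
Definition outer_null A : Prop := forall e : R, 0 < e ->
  exists a b : nat -> 'rV[R]_n,
    [/\ forall (k : nat) (i : 'I_n), a k 0 i <= b k 0 i,
        A `<=` \bigcup_k box (a k) (b k)
      & forall M : nat, \sum_(0 <= k < M) box_volume (a k) (b k) <= e].

Lemma box_volume_ge0 a b :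
  (forall i : 'I_n, a 0 i <= b 0 i) -> 0 <= box_volume a b.
Proof. by move=> ab; apply: prodr_ge0 => i _; rewrite subr_ge0. Qed.

Lemma outer_null_lebesgue A : outer_null A -> lebesgue_outer A = 0%E.
Proof.
move=> Anull; apply/eqP; rewrite eq_le; apply/andP; split; last first.
  apply: le_ereal_inf_tmp => _ [a [b [ab _ ->]]].
  by apply: nneseries_ge0 => k _ _; rewrite lee_fin box_volume_ge0.
apply/lee_addgt0Pr => e e0; rewrite add0e.
have [a [b [ab Aab sumab]]] := Anull e e0.
apply: (@le_trans _ _ (\sum_(0 <= k <oo) (box_volume (a k) (b k))%:E)%E).
  by apply: ereal_inf_lbound; exists a, b.
apply: lime_le.
  by apply: is_cvg_nneseries => k _ _; rewrite lee_fin box_volume_ge0.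
by apply: nearW => M; rewrite sumEFin lee_fin.
Qed.

Lemma outer_null_sub A B : A `<=` B -> outer_null B -> outer_null A.
Proof.
move=> AB Bnull e e0; have [a [b [ab Bab sumab]]] := Bnull e e0.
by exists a, b; split => //; apply: subset_trans Bab.
Qed.

(** Lets covers be indexed by whatever countable type fits the construction: a
    finite grid, or pairs for a union of covers. Codes that encode no index get a
    degenerate box, which has volume 0 because there is at least one
    coordinate. *)
Lemma countable_cover (hn : (0 < n)%N) (I : countType) A
    (a b : I -> 'rV[R]_n) (e : R) :
    (forall k (i : 'I_n), a k 0 i <= b k 0 i) ->
    A `<=` \bigcup_k box (a k) (b k) ->
    (forall s : seq I, uniq s -> \sum_(k <- s) box_volume (a k) (b k) <= e) ->
  exists a' b' : nat -> 'rV[R]_n,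
    [/\ forall (k : nat) (i : 'I_n), a' k 0 i <= b' k 0 i,
        A `<=` \bigcup_k box (a' k) (b' k)
      & forall M : nat, \sum_(0 <= k < M) box_volume (a' k) (b' k) <= e].
Proof.
move=> ab Aab sumab.
exists (fun m => oapp a 0 (pickle_inv m)), (fun m => oapp b 0 (pickle_inv m)).
split.
- by move=> m i; case: pickle_inv => [k|] //=.
- move=> x /Aab[k _ xk]; exists (pickle k) => //.
  by rewrite pickleK_inv.
- move=> M; have := sumab _ (pmap_uniq (@pickle_invK I) (iota_uniq 0 M)).
  apply: le_trans; rewrite big_pmap /index_iota subn0.
  apply: ler_sum => m _; case: pickle_inv => //=.
  rewrite /box_volume (bigD1 (Ordinal hn)) //= subrr mul0r.
  exact: lexx.
Qed.

Lemma ler_sum_uniq_sub (I : eqType) (s t : seq I) (F : I -> R) :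
  uniq s -> uniq t -> {subset s <= t} -> (forall i, 0 <= F i) ->
  \sum_(i <- s) F i <= \sum_(i <- t) F i.
Proof.
move=> us ut st F0; rewrite [leRHS](bigID (mem s)) /=.
rewrite -[X in _ <= X + _]big_filter.
have E : perm_eq [seq i <- t | i \in s] s.
  apply: uniq_perm; rewrite ?filter_uniq// => i; rewrite mem_filter.
  by apply: andb_idr; exact: st.
by rewrite (perm_big _ E) lerDl; apply: sumr_ge0.
Qed.

Lemma sum_half_powers (e : R) (M : nat) :
  \sum_(0 <= m < M) e / 2 ^+ m.+1 = e - e / 2 ^+ M.
Proof.
elim: M => [|M IH]; first by rewrite big_nil expr0 divr1 subrr.
rewrite big_nat_recr //= IH exprS; field.
by rewrite expf_neq0.
Qed.

Lemma sum_half_powers_pickle (I : countType) (e : R) (s : seq I) :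
  0 <= e -> uniq s -> \sum_(k <- s) e / 2 ^+ (pickle k).+1 <= e.
Proof.
move=> e0 us.
have us' : uniq (map pickle s).
  by rewrite map_inj_uniq //; exact: (pcan_inj (@pickleK I)).
pose M := (\max_(m <- map pickle s) m).+1.
have e2 m : 0 <= e / 2 ^+ m by rewrite divr_ge0// exprn_ge0.
apply: (@le_trans _ _ (\sum_(m <- map pickle s) e / 2 ^+ m.+1)).
  by rewrite big_map.
apply: (@le_trans _ _ (\sum_(0 <= m < M) e / 2 ^+ m.+1)).
  apply: ler_sum_uniq_sub => // [|m ms]; first exact: iota_uniq.
  by rewrite mem_index_iota ltnS /=; exact: leq_bigmax_seq.
by rewrite sum_half_powers gerBl.
Qed.

(** The k-th set is given the share e / 2 ^ (k + 1) of the total volume. *)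
Lemma outer_null_bigcup (hn : (0 < n)%N) (K : countType)
    (A : K -> set 'rV[R]_n) :
  (forall k, outer_null (A k)) -> outer_null (\bigcup_k A k).
Proof.
move=> Anull e e0.
have ek k : 0 < e / 2 ^+ (@pickle K k).+1 by rewrite divr_gt0// exprn_gt0.
have /choice[ab abP] : forall k, exists ab : (nat -> 'rV[R]_n) * (nat -> 'rV[R]_n),
    [/\ forall (j : nat) (i : 'I_n), ab.1 j 0 i <= ab.2 j 0 i,
        A k `<=` \bigcup_j box (ab.1 j) (ab.2 j)
      & forall M : nat, \sum_(0 <= j < M) box_volume (ab.1 j) (ab.2 j)
          <= e / 2 ^+ (pickle k).+1].
  by move=> k; have [a [b abk]] := Anull k _ (ek k); exists (a, b).
refine (@countable_cover hn (K * nat)%type _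
  (fun q => (ab q.1).1 q.2) (fun q => (ab q.1).2 q.2) e _ _ _).
- by move=> [k j] i; have [+ _ _] := abP k; apply.
- move=> x [k _ Akx]; have [_ /(_ _ Akx)[j _ xj] _] := abP k.
  by exists (k, j).
move=> s us.
pose v (q : K * nat) := box_volume ((ab q.1).1 q.2) ((ab q.1).2 q.2).
have v0 q : 0 <= v q by apply: box_volume_ge0; have [+ _ _] := abP q.1; apply.
(* A finite family of boxes fits in a rectangle of indices. *)
pose M := (\max_(m <- map snd s) m).+1.
pose ks := undup (map fst s).
apply: (@le_trans _ _
    (\sum_(q <- [seq (k, j) | k <- ks, j <- index_iota 0 M]) v q)).
  apply: ler_sum_uniq_sub => //.
    by apply: allpairs_uniq; rewrite ?undup_uniq ?iota_uniq// => -[? ?] [? ?].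
  move=> [k j] kjs; apply/allpairsP; exists (k, j); split => //=.
    by rewrite mem_undup; apply/mapP; exists (k, j).
  rewrite mem_index_iota ltnS /=; apply: leq_bigmax_seq => //.
  by apply/mapP; exists (k, j).
rewrite big_allpairs_dep.
apply: le_trans (sum_half_powers_pickle _ _ _ (ltW e0) (undup_uniq (map fst s))).
by apply: ler_sum => k _; have [_ _] := abP k; apply.
Qed.

End NullSets.

(** * Lipschitz graphs are null *)

Section LipschitzGraphs.
Context {R : realType} {n : nat}.
Implicit Types (A B : set 'rV[R]_n) (x y c : 'rV[R]_n).

(** Equivalent to A being part of the graph of an L-Lipschitz function (for the
    l1 norm) giving the i-th coordinate in terms of the others; the two-point form passes
    to subsets at once. *)
Definition lipschitz_graph (i : 'I_n) (L : R) A : Prop := forall x y,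
  A x -> A y -> `|x 0 i - y 0 i| <= L * \sum_(j < n | j != i) `|x 0 j - y 0 j|.

Lemma sub_lipschitz_graph (i : 'I_n) (L : R) A B :
  A `<=` B -> lipschitz_graph i L B -> lipschitz_graph i L A.
Proof. by move=> AB graphB x y /AB Bx /AB By; exact: graphB. Qed.

(** The other n - 1 coordinates are cut into (N + 1)^(n-1) cells of side s of
    order 1 / (N + 1). Above a cell, the i-th coordinate on A stays within L n s
    of its value at any one point of A there, so a box of volume
    2 L n s * s^(n-1) suffices, and the total volume is of order 1 / (N + 1). *)
Lemma outer_null_lipschitz_graph (i : 'I_n) (L r : R) c A :
    0 <= L -> 0 < r ->
    A `<=` cube c r ->
    lipschitz_graph i L A -> outer_null A.
Proof.
move=> L0 r0 Abnd Agraph e e0.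
have hn : (0 < n)%N by apply: leq_ltn_trans (ltn_ord i).
(* W / N.+1 is the total volume of the cover computed at the end. *)
pose W : R := 4 * L * n%:R * r * \prod_(j < n | j != i) (2 * r).
have W0 : 0 <= W.
  by rewrite !mulr_ge0 ?ler0n ?(ltW r0)//; apply: prodr_ge0 => j _; lra.
pose N := Num.truncn (W / e).
have N0 : 0 < N.+1%:R :> R by rewrite ltr0n.
have WN : W / N.+1%:R <= e.
  rewrite ler_pdivrMr// mulrC -ler_pdivrMr//.
  by have /andP[_ /ltW] := truncn_itv (divr_ge0 W0 (ltW e0)).
pose s : R := 2 * r / N.+1%:R.
have s0 : 0 < s by rewrite divr_gt0// mulr_gt0.
have Ns : N.+1%:R * s = 2 * r by rewrite /s mulrC divfK// gt_eqF.
pose D : R := L * n%:R * s.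
have D0 : 0 <= D by rewrite !mulr_ge0// ltW.
pose lo (f : {ffun 'I_n -> 'I_N.+1}) (j : 'I_n) := c 0 j - r + (f j)%:R * s.
pose cell f x := forall j : 'I_n, j != i -> lo f j <= x 0 j <= lo f j + s.
have /choice[y yP] : forall f, exists y,
    (exists x, A x /\ cell f x) -> A y /\ cell f y.
  move=> f; have [[x Hx]|noA] := pselect (exists x, A x /\ cell f x).
    by exists x.
  by exists 0.
(* Every cell of the grid occurs N.+1 times in this indexing, once for each
   value of f i; only the copy with f i = 0 gets a thick box. *)
pose w (f : {ffun 'I_n -> 'I_N.+1}) : R := if f i == ord0 then D else 0.
have w0 f : 0 <= w f by rewrite /w; case: ifP.
pose a f : 'rV[R]_n :=
  \row_(j < n) (if j == i then y f 0 i - w f else lo f j).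
pose b f : 'rV[R]_n :=
  \row_(j < n) (if j == i then y f 0 i + w f else lo f j + s).
apply: (@countable_cover _ _ hn _ _ a b).
- move=> f j; rewrite !mxE; case: eqP => _; last by rewrite lerDl ltW.
  by have := w0 f; lra.
- move=> x Ax.
  pose q (j : 'I_n) := (x 0 j - c 0 j + r) / s.
  have qbnd j : 0 <= q j < N.+1%:R.
    have := Abnd x Ax j; rewrite ltr_norml => /andP[xl xu].
    rewrite divr_ge0 ?(ltW s0)//=; last by lra.
    by rewrite ltr_pdivrMr// Ns; lra.
  pose f : {ffun 'I_n -> 'I_N.+1} :=
    [ffun j => if j == i then ord0 else inord (Num.truncn (q j))].
  have cellx : cell f x.
    move=> j ji; rewrite /lo ffunE (negbTE ji) inordK; last first.
      have /andP[q0 qN] := qbnd j.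
      by rewrite ltnS truncn_le_nat.
    have /andP[q0 _] := qbnd j; have /andP[tl tu] := truncn_itv q0.
    have qs : q j * s = x 0 j - c 0 j + r by rewrite /q divfK// gt_eqF.
    have := ler_wpM2r (ltW s0) tl; have := ltW tu => /(ler_wpM2r (ltW s0)).
    by rewrite qs -natr1 mulrDl mul1r => *; lra.
  have [Ay celly] := yP f (ex_intro _ x (conj Ax cellx)).
  exists f => // j; rewrite !mxE; case: eqP => [->|/eqP ji]; last exact: cellx.
  have wD : w f = D by rewrite /w ffunE !eqxx.
  have : `|x 0 i - y f 0 i| <= D.
    apply: (le_trans (Agraph _ _ Ax Ay)).
    rewrite /D -mulrA ler_wpM2l//.
    apply: (@le_trans _ _ (\sum_(j < n | j != i) s)).
      apply: ler_sum => k ki; rewrite ler_norml.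
      by have := cellx _ ki; have := celly _ ki => /andP[? ?] /andP[? ?]; lra.
    rewrite sumr_const -[leLHS]mulr_natl ler_wpM2r ?(ltW s0)// ler_nat.
    by rewrite -[leqRHS]card_ord max_card.
  by rewrite wD ler_norml => /andP[? ?]; lra.
move=> t ut.
pose G (j : 'I_n) (k : 'I_N.+1) : R :=
  if j == i then (if k == ord0 then 2 * D else 0) else s.
have volE f : box_volume (a f) (b f) = \prod_(j < n) G j (f j).
  apply: eq_bigr => j _; rewrite !mxE /G /w; case: eqP => [->|_]; last by ring.
  by case: ifP => _; ring.
have G0 j k : 0 <= G j k.
  by rewrite /G; case: ifP => _; [case: ifP => _ //; lra|exact: ltW].
apply: (@le_trans _ _ (\sum_(f : {ffun 'I_n -> 'I_N.+1}) \prod_(j < n) G j (f j))).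
  under eq_bigr do rewrite volE.
  rewrite -[leRHS]big_enum; apply: ler_sum_uniq_sub => //.
  - exact: enum_uniq.
  - by move=> f _; rewrite mem_enum.
  - by move=> f; apply: prodr_ge0.
(* The volume depends on each f j separately, so the sum over the grid is a
   product of one-coordinate sums: 2 * D for i and 2 * r for the others. *)
rewrite -bigA_distr_bigA (bigD1 i)//= {1}/G eqxx.
rewrite -big_mkcond /= big_pred1_eq.
rewrite (eq_bigr (fun=> 2 * r)); last first.
  move=> j ji; rewrite /G (negbTE ji) sumr_const card_ord.
  by rewrite -[LHS]mulr_natl Ns.
apply: le_trans WN; rewrite /W /D /s le_eqVlt; apply/orP; left; apply/eqP.
by field; rewrite gt_eqF.
Qed.

End LipschitzGraphs.

(** * Functions with continuous partial derivatives *)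

Section Calculus.
Context {R : realType} {n : nat}.
Implicit Types (f : 'rV[R]_n -> R) (a v x y z c : 'rV[R]_n).

Lemma growth_rate_line f a v (t : R) :
  (fun s : R => s^-1 *: (((fun u : R => f (a + u *: v)) \o shift t) (s *: 1)
     - f (a + t *: v))) =
  (fun s : R => s^-1 *: ((f \o shift (a + t *: v)) (s *: v) - f (a + t *: v))).
Proof.
apply/funext => s; congr (_ *: (f _ - _)).
by rewrite /= [s *: 1]mulr1 scalerDl addrCA.
Qed.

Lemma is_derive_lineP f a v (t d : R) :
  is_derive (a + t *: v) v f d <-> is_derive t 1 (fun s : R => f (a + s *: v)) d.
Proof.
have E := growth_rate_line f a v t.
split=> -[dv dE]; split.
- by rewrite /derivable E.
- by rewrite /derive E.
- by rewrite /derivable -E.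
- by rewrite /derive -E.
Qed.

Lemma is_derive_line0P f a v (d : R) :
  is_derive a v f d <-> is_derive (0 : R) 1 (fun s : R => f (a + s *: v)) d.
Proof. by rewrite -is_derive_lineP scale0r addr0. Qed.

Lemma is_derive_scale f a v (k d : R) :
  is_derive a v f d -> is_derive a (k *: v) f (k * d).
Proof.
move=> /is_derive_line0P fd; apply/is_derive_line0P.
have dk : is_derive (0 : R) 1 (k \*: (@idfun R)) k.
  by apply: is_derive_eq; rewrite [LHS]mulr1.
rewrite (_ : (fun s => _) = (fun s : R => f (a + s *: v)) \o (k \*: (@idfun R))).
  by rewrite mulrC; apply: is_derive1_comp; rewrite /= scaler0.
by apply/funext => s /=; rewrite scalerA mulrC.
Qed.

Lemma mean_value_segment f a v :
  (forall s : R, derivable f (a + s *: v) v) ->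
  exists2 s : R, 0 <= s <= 1 & f (a + v) - f a = 'D_v f (a + s *: v).
Proof.
move=> dfv.
have dg (s : R) : is_derive s 1 (fun s : R => f (a + s *: v)) ('D_v f (a + s *: v)).
  by apply/is_derive_lineP; apply: DeriveDef.
have cg : {within `[0, 1], continuous (fun s : R => f (a + s *: v))}.
  apply: continuous_subspaceT => s; apply/differentiable_continuous.
  by apply/derivable1_diffP; have [] := dg s.
have [s s01 E] := MVT_segment ler01 (fun s _ => dg s) cg.
exists s; first by move: s01; rewrite in_itv.
by move: E; rewrite scale1r scale0r addr0 subr0 mulr1.
Qed.

(** The corners of a path from y to x that changes one coordinate at a time. *)
Definition mixed x y (k : nat) : 'rV[R]_n :=
  \row_(j < n) (if (j < k)%N then x 0 j else y 0 j).

Lemma mixedS x y (k : 'I_n) :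
  mixed x y k.+1 = mixed x y k + (x 0 k - y 0 k) *: basis_vec k.
Proof.
apply/rowP => j; rewrite !mxE eqxx /= ltnS leq_eqVlt.
have [->|jk] := eqVneq j k; first by rewrite eqxx ltnn /= mulr1 addrC subrK.
by rewrite (negbTE (_ : val j != val k)) //= mulr0 addr0.
Qed.

(** Along the path through the [mixed] points only one partial derivative acts
    on each leg, so the one-variable mean value theorem applies n times; the path
    stays in the cube because the cube is a product of intervals. *)
Lemma mean_value_cube f c x y (w : 'I_n -> R) (d e : R) :
    (forall i z, derivable f z (basis_vec i)) ->
    cube c d x -> cube c d y ->
    (forall z, cube c d z -> forall j, `|partial j f z - w j| <= e) ->
  `|f x - f y - \sum_(j < n) w j * (x 0 j - y 0 j)|
    <= e * \sum_(j < n) `|x 0 j - y 0 j|.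
Proof.
move=> df xc yc dfe.
have -> : f x - f y = \sum_(k < n) (f (mixed x y k.+1) - f (mixed x y k)).
  rewrite -(big_mkord predT (fun k => f (mixed x y k.+1) - f (mixed x y k))).
  rewrite telescope_sumr //; congr (f _ - f _); apply/rowP => j; rewrite mxE //.
  by rewrite ltn_ord.
rewrite -sumrB mulr_sumr; apply: (le_trans (ler_norm_sum _ _ _)).
apply: ler_sum => k _; rewrite mixedS.
set t := x 0 k - y 0 k; set z := mixed x y k.
have dfk u : is_derive u (t *: basis_vec k) f (t * partial k f u).
  by apply: is_derive_scale; exact: DeriveDef.
have [u|s s01 ->] := @mean_value_segment f z (t *: basis_vec k).
  by have [] := dfk (z + u *: (t *: basis_vec k)).
rewrite (@derive_val _ _ _ _ _ _ _ (dfk _)) [w k * t]mulrC -mulrBr normrM mulrC.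
apply: ler_wpM2r => //; apply: dfe => j.
rewrite scalerA !mxE eqxx /=; have := xc j; have := yc j; rewrite /t.
have [->|jk] := eqVneq j k; last by rewrite mulr0 addr0; case: ifP.
rewrite ltnn mulr1 !ltr_norml => /andP[? ?] /andP[? ?]; move/andP: s01 => [? ?].
by have [?|/ltW ?] := lerP (x 0 k) (y 0 k); apply/andP; split; nra.
Qed.

Lemma continuous_row_near (f : 'rV[R]_n -> R) c (e : R) :
  {for c, continuous f} -> 0 < e -> exists2 d : R, 0 < d &
    forall z, cube c d z -> `|f z - f c| <= e.
Proof.
move=> /cvgrPdist_le fc e0; have := fc e e0.
move=> /nbhs_ballP[d /= d0 dP]; exists d => // z zc.
rewrite distrC; apply: dP; split => // i j.
by rewrite ord1 /ball /= distrC.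
Qed.

Lemma partials_near f c (e : R) :
  Ck 1 f -> 0 < e -> exists2 d : R, 0 < d &
    forall z, cube c d z ->
    forall j, `|partial j f z - partial j f c| <= e.
Proof.
move=> [_ fC1] e0.
have /choice[d dP] : forall j, exists d : R, 0 < d /\
    forall z, cube c d z ->
      `|partial j f z - partial j f c| <= e.
  move=> j; have [_ jC] := fC1 j.
  by have [d d0 dP] := @continuous_row_near (partial j f) c e (jC c) e0; exists d.
exists (\big[Order.min/1]_(j < n) d j).
  by apply: lt_bigmin => // j _; have [] := dP j.
move=> z zc j; have [_] := dP j; apply => k.
by apply: lt_le_trans (zc k) _; exact: bigmin_le.
Qed.

(** [mean_value_cube] on shrinking cubes around a bounds the error of the linear
    approximation along v. *)
Lemma is_derive_C1 f a v :
  Ck 1 f -> is_derive a v f (\sum_(j < n) v 0 j * partial j f a).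
Proof.
move=> fC1; have [_ df] := fC1.
set l := \sum_(j < n) _.
have cvl : (fun s : R => s^-1 *: ((f \o shift a) (s *: v) - f a)) @ 0^' --> l.
  apply/cvgrPdist_le => /= e e0.
  (* The summand 1 keeps S positive when v = 0. *)
  pose S := 1 + \sum_(j < n) `|v 0 j|.
  have S0 : 0 < S by rewrite ltr_pwDl// sumr_ge0.
  have [d d0 dP] := @partials_near f a (e / S) fC1 (divr_gt0 e0 S0).
  near=> s.
  have s0 : s != 0 by near: s; exact: nbhs_dnbhs_neq.
  have sd : `|s| < d / S by near: s; apply: dnbhs0_lt; exact: divr_gt0.
  have sv j : `|s * v 0 j| < d.
    rewrite normrM; apply: (@le_lt_trans _ _ (`|s| * S)).
      apply: ler_wpM2l => //; rewrite /S (bigD1 j)//= addrCA lerDl.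
      by rewrite addr_ge0// sumr_ge0.
    by rewrite -ltr_pdivlMr.
  have asv (j : 'I_n) : (a + s *: v) 0 j - a 0 j = s * v 0 j.
    by rewrite !mxE addrAC subrr add0r.
  have : `|f (a + s *: v) - f a - s * l| <= e * `|s|.
    have -> : s * l =
        \sum_(j < n) partial j f a * ((a + s *: v) 0 j - a 0 j).
      by rewrite /l mulr_sumr; apply: eq_bigr => j _; rewrite asv; ring.
    have dfi i z : derivable f z (basis_vec i) by have [+ _] := df i; apply.
    have asd : cube a d (a + s *: v) by move=> j; rewrite asv.
    have aad : cube a d a by move=> j; rewrite subrr normr0.
    apply: (le_trans (mean_value_cube _ _ _ _ _ _ _ dfi asd aad dP)).
    under eq_bigr do rewrite asv normrM.
    rewrite -mulr_sumr mulrCA mulrC ler_wpM2r// mulrAC ler_pdivrMr//.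
    by rewrite ler_wpM2l ?(ltW e0)// /S lerDr.
  rewrite /= [s *: v + a]addrC => H.
  have -> : l - s^-1 *: (f (a + s *: v) - f a) =
      - (s^-1 * (f (a + s *: v) - f a - s * l)).
    by rewrite /GRing.scale /=; field.
  by rewrite normrN normrM normfV ler_pdivrMl ?normr_gt0// [leRHS]mulrC.
split; first by apply/cvg_ex; exists l.
exact: cvg_lim cvl.
Unshelve. all: by end_near. Qed.

End Calculus.

(** * Injectivity of the gradient *)

Section HomogeneousConvex.
Context {R : realType} {n : nat}.
Implicit Types (f h : 'rV[R]_n -> R) (a b v x : 'rV[R]_n).

(** Differentiating f (t x + s t e_i) = t ^ q f (x + s e_i) at s = 0 gives
    t * partial i f (t x) = t ^ q * partial i f x. *)
Lemma pos_homogeneous_partial (q : R) f (i : 'I_n) :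
  (forall x, derivable f x (basis_vec i)) ->
  pos_homogeneous q f -> pos_homogeneous (q - 1) (partial i f).
Proof.
move=> df fq t x t0.
have dfx y : is_derive y (basis_vec i) f (partial i f y) by apply: DeriveDef.
have d1 := is_derive_scale _ _ _ t _ (dfx (t *: x)).
have d2 : is_derive (t *: x) (t *: basis_vec i) f (t `^ q * partial i f x).
  apply/is_derive_line0P.
  rewrite (_ : (fun s => _) = t `^ q \*: (fun s : R => f (x + s *: basis_vec i))).
    by apply: is_deriveZ; exact/is_derive_line0P.
  by apply/funext => s /=; rewrite scalerA [s * t]mulrC -scalerA -scalerDr fq.
apply: (mulfI (lt0r_neq0 t0)).
rewrite -(@derive_val _ _ _ _ _ _ _ d1) (@derive_val _ _ _ _ _ _ _ d2) mulrA.
congr (_ * _); rewrite -{1}(subrK 1 q) (powRD (x := t) (r := q - 1) (s := 1)); last first.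
  by apply/implyP => _; rewrite gt_eqF.
by rewrite powRr1 ?(ltW t0)// mulrC.
Qed.

Lemma dotp_gt0 x : x != 0 -> 0 < dotp x x.
Proof.
move=> /eqP x0; rewrite lt_def sumr_ge0 ?andbT => [|i _]; last first.
  by rewrite -expr2 sqr_ge0.
apply/eqP => /eqP; rewrite psumr_eq0 => [|i _]; last by rewrite -expr2 sqr_ge0.
move=> /allP xx0; apply: x0; apply/rowP => i; rewrite mxE.
have := xx0 i (mem_index_enum i).
by rewrite /= mulf_eq0 orbb => /eqP.
Qed.

(** By homogeneity the Hessian at x is a positive multiple of the Hessian at
    x / |x|. *)
Lemma hessian_pos_def (p : R) h :
    Ck 2 h -> pos_homogeneous p h ->
    (forall x, unit_sphere x -> pos_def (hessian h x)) ->
  forall x, x != 0 -> pos_def (hessian h x).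
Proof.
move=> [_ hC2] hp hess x x0 v v0.
pose t := Num.sqrt (dotp x x).
have t0 : 0 < t by rewrite sqrtr_gt0 dotp_gt0.
pose u := t^-1 *: x.
have xE : x = t *: u by rewrite /u scalerA divff ?scale1r// gt_eqF.
have u1 : unit_sphere u.
  rewrite /unit_sphere /= /u /dotp.
  under eq_bigr do rewrite !mxE mulrACA.
  rewrite -mulr_sumr -[X in _ * X]/(dotp x x) -invfM -expr2.
  by rewrite sqr_sqrtr ?mulVf ?gt_eqF// ?ltW// dotp_gt0.
have -> : hessian h x = t `^ (p - 1 - 1) *: hessian h u.
  apply/matrixP => i j; rewrite !mxE [in LHS]xE.
  have [dh [_ dh2]] := hC2 j; have [ddh _] := dh2 i.
  apply: pos_homogeneous_partial => //.
  by apply: pos_homogeneous_partial => // y; have [+ _] := hC2 j; apply.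
rewrite -scalemxAl linearZ /=.
rewrite (_ : dotp _ _ = t `^ (p - 1 - 1) * dotp (hessian h u *m v^T)^T v).
  by rewrite mulr_gt0 ?powR_gt0// hess.
by rewrite /dotp mulr_sumr; apply: eq_bigr => i _; rewrite [in LHS]mxE mulrA.
Qed.

(** The sum being differentiated is the derivative of h along the line
    s |-> a + s v, so this is the second derivative of h along that line. *)
Lemma is_derive_slope h a v (t : R) : Ck 2 h ->
  is_derive t 1 (fun s : R => \sum_(j < n) v 0 j * partial j h (a + s *: v))
    (dotp (hessian h (a + t *: v) *m v^T)^T v).
Proof.
move=> [_ hC2].
rewrite (_ : (fun s => _) =
    \sum_(j < n) (v 0 j \*: (fun s : R => partial j h (a + s *: v)))); last first.
  by apply/funext => s; rewrite fct_sumE.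
rewrite (_ : dotp _ _ = \sum_(j < n) v 0 j *:
    \sum_(i < n) v 0 i * partial i (partial j h) (a + t *: v)).
  apply: is_derive_sum => j; apply: is_deriveZ; apply/is_derive_lineP.
  by apply: is_derive_C1; have [_] := hC2 j.
rewrite /dotp; under eq_bigr do rewrite !mxE mulr_suml.
rewrite exchange_big; apply: eq_bigr => j _; rewrite [RHS]mulr_sumr.
by apply: eq_bigr => i _; rewrite !mxE; ring.
Qed.

(** With equal gradients at a and b, the slope G of h along the segment would
    take the same value at both ends. But G has a positive derivative except
    where the segment meets the origin, which happens at most once; cutting the
    segment there, G increases strictly on each part. *)
Lemma gradient_injective h a b : Ck 2 h ->
    (forall x, x != 0 -> pos_def (hessian h x)) ->
  (forall j, partial j h a = partial j h b) -> a = b.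
Proof.
move=> hC2 hess eqab; apply: contrapT => /eqP ab.
pose v := b - a; have v0 : v != 0 by rewrite subr_eq0 eq_sym.
pose G (t : R) := \sum_(j < n) v 0 j * partial j h (a + t *: v).
have dG (t : R) := is_derive_slope h a v t hC2.
have Glt (s t : R) : s < t ->
    (forall u, s < u < t -> a + u *: v != 0) -> G s < G t.
  move=> st nz.
  have cG : {within `[s, t], continuous G}.
    apply: continuous_subspaceT => u; apply/differentiable_continuous.
    by apply/derivable1_diffP; have [] := dG u.
  have [u + E] := MVT st (fun u _ => dG u) cG.
  rewrite in_itv /= => ust.
  by rewrite -subr_gt0 E mulr_gt0 ?subr_gt0// hess// nz.
have G01 : G 0 = G 1.
  apply: eq_bigr => j _.
  by rewrite scale0r addr0 scale1r /v [a + _]addrC subrK eqab.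
have [[u /andP[u0 u1] uz]|noz] := pselect (exists2 u, 0 < u < 1 & a + u *: v = 0).
  have uniq_zero w : w != u -> a + w *: v != 0.
    apply: contra => /eqP wz; apply/eqP.
    have /eqP : (w - u) *: v = 0.
      have wE : w *: v = - a by apply/eqP; rewrite -addr_eq0 addrC wz.
      have uE : u *: v = - a by apply/eqP; rewrite -addr_eq0 addrC uz.
      by rewrite scalerBl wE uE subrr.
    by rewrite scaler_eq0 (negbTE v0) orbF subr_eq0 => /eqP.
  have : G 0 < G u.
    by apply: Glt => // w /andP[_ wu]; apply: uniq_zero; rewrite lt_eqF.
  have : G u < G 1.
    by apply: Glt => // w /andP[wu _]; apply: uniq_zero; rewrite gt_eqF.
  by rewrite G01 => /lt_trans H /H; rewrite ltxx.
have : G 0 < G 1.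
  by apply: Glt => // w w01; apply/eqP => wz; apply: noz; exists w.
by rewrite G01 ltxx.
Qed.

End HomogeneousConvex.

(** * Monotone maps *)

Section MonotoneMaps.
Context {R : realType} {n : nat}.
Implicit Types (h : 'rV[R]_n -> R) (T : 'rV[R]_n -> set 'rV[R]_n).
Implicit Types (x y c xi zeta : 'rV[R]_n).

Definition two_valued T c c1 c2 (r : R) : set 'rV[R]_n :=
  [set x | cube c r x /\
    (exists2 xi, T x xi & cube c1 r xi) /\
    (exists2 zeta, T x zeta & cube c2 r zeta)].

(** Let w be the difference of the two gradients and m = |w i| its largest
    coordinate. On a small enough piece |<w, x - y>| <= (m / 2) |x - y|_1, so with
    t = |x_i - y_i| and S the sum of the other |x_j - y_j|,
    m t <= (m / 2) (t + S) + m S, that is t <= 3 S. Picking the largest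
    coordinate makes the constant 3 independent of the piece. *)
Lemma two_valued_lipschitz_graph h T x0 xi0 zeta0 :
    Ck 1 h -> h_monotone h T ->
    (exists j : 'I_n, partial j h (x0 - xi0) != partial j h (x0 - zeta0)) ->
  exists i : 'I_n, exists2 d : R, 0 < d &
    lipschitz_graph i 3 (two_valued T x0 xi0 zeta0 d).
Proof.
move=> hC1 hT [j0 j0P].
pose P j := partial j h (x0 - xi0); pose Q j := partial j h (x0 - zeta0).
pose w j := P j - Q j.
pose i := [arg max_(i > j0) `|w i|]%O; pose m := `|w i|.
have wm j : `|w j| <= m.
  by rewrite /m /i; case: arg_maxP => // k _; apply.
have m0 : 0 < m.
  by apply: lt_le_trans (wm j0); rewrite normr_gt0 subr_eq0.
have m40 : 0 < m / 4 by rewrite divr_gt0.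
have [d1 d10 d1P] := partials_near h (x0 - xi0) (m / 4) hC1 m40.
have [d2 d20 d2P] := partials_near h (x0 - zeta0) (m / 4) hC1 m40.
exists i; exists (Order.min d1 d2 / 2); first by rewrite divr_gt0// lt_min d10.
set d := _ / 2.
have dd1 : d + d <= d1 by rewrite /d -splitr ge_min lexx.
have dd2 : d + d <= d2 by rewrite /d -splitr ge_min lexx orbT.
have cubeB x c xi c' (r : R) : cube c d x -> cube c' d xi -> d + d <= r ->
    cube (c - c') r (x - xi).
  move=> cx cxi dr j; rewrite !mxE; apply: lt_le_trans dr.
  rewrite (_ : _ - _ = (x 0 j - c 0 j) - (xi 0 j - c' 0 j)); last by ring.
  by apply: (le_lt_trans (ler_normB _ _)); rewrite ltrD.
have dh k z : derivable h z (basis_vec k) by have [_ /(_ k)[+ _]] := hC1; apply.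
have mean_value W c r u x y : cube c r (x - u) -> cube c r (y - u) ->
    (forall z, cube c r z -> forall j, `|partial j h z - W j| <= m / 4) ->
    `|h (x - u) - h (y - u) - \sum_(j < n) W j * (x 0 j - y 0 j)|
      <= m / 4 * \sum_(j < n) `|x 0 j - y 0 j|.
  move=> cx cy cW; have := mean_value_cube _ _ _ _ _ _ _ dh cx cy cW.
  have subE j : (x - u) 0 j - (y - u) 0 j = x 0 j - y 0 j.
    by rewrite !mxE; ring.
  under eq_bigr do rewrite subE.
  by under [in leRHS]eq_bigr do rewrite subE.
(* One half of the estimate, from the value of T x near xi0 and the value of
   T y near zeta0; exchanging x and y gives the other half. *)
have key x y : two_valued T x0 xi0 zeta0 d x -> two_valued T x0 xi0 zeta0 d y ->
    \sum_(j < n) w j * (x 0 j - y 0 j) <= m / 2 * \sum_(j < n) `|x 0 j - y 0 j|.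
  move=> [cx [[xi Txi cxi] _]] [cy [_ [zeta Tzeta czeta]]].
  have mono := hT _ _ (ex_intro _ _ Txi) (ex_intro _ _ Tzeta) _ _ Txi Tzeta.
  have := mean_value P _ _ _ _ _ (cubeB _ _ _ _ _ cx cxi dd1)
    (cubeB _ _ _ _ _ cy cxi dd1) d1P.
  have := mean_value Q _ _ _ _ _ (cubeB _ _ _ _ _ cx czeta dd2)
    (cubeB _ _ _ _ _ cy czeta dd2) d2P.
  rewrite !ler_norml => /andP[? ?] /andP[? ?].
  rewrite /w; under eq_bigr do rewrite mulrBl.
  by rewrite sumrB; lra.
move=> x y Ax Ay.
have k1 := key _ _ Ax Ay; have k2 := key _ _ Ay Ax.
have {k2} : - \sum_(j < n) w j * (x 0 j - y 0 j)
    <= m / 2 * \sum_(j < n) `|x 0 j - y 0 j|.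
  rewrite -sumrN; under eq_bigr do rewrite -mulrN opprB.
  by under [in leRHS]eq_bigr do rewrite distrC.
move: k1; rewrite !(bigD1 (P := predT) i)//=.
set t := x 0 i - y 0 i; set S := \sum_(j < n | _) `|_|.
set U := \sum_(j < n | _) _ * _ => k1 k2.
have : `|U| <= m * S.
  apply: (le_trans (ler_norm_sum _ _ _)); rewrite mulr_sumr.
  by apply: ler_sum => j _; rewrite normrM ler_wpM2r.
have : m * `|t| = `|w i * t| by rewrite normrM.
rewrite ler_norml => wt /andP[? ?].
rewrite -(ler_pM2l m0).
have : `|w i * t| <= m / 2 * (`|t| + S) + m * S.
  by rewrite ler_norml; apply/andP; split; lra.
by rewrite -wt; lra.
Qed.

Lemma rational_approx x (r : R) : 0 < r ->
  exists q : 'rV[rat]_n, cube (map_mx ratr q) r x.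
Proof.
move=> r0.
have /choice[q qP] : forall j : 'I_n, exists q : rat, `|x 0 j - ratr q| < r.
  move=> j; have [|q] := @rat_in_itvoo R (x 0 j - r) (x 0 j + r); first by lra.
  rewrite in_itv /= => /andP[? ?]; exists q.
  by rewrite ltr_norml; apply/andP; split; lra.
by exists (\row_j q j) => j; rewrite !mxE.
Qed.

Lemma sub_two_valued T c c1 c2 x0 xi0 zeta0 (r d : R) :
    r + r <= d -> cube c r x0 -> cube c1 r xi0 -> cube c2 r zeta0 ->
  two_valued T c c1 c2 r `<=` two_valued T x0 xi0 zeta0 d.
Proof.
move=> rd cx c1xi c2zeta.
have cubeS u v : cube u r v -> cube u r `<=` cube v d.
  move=> uv y uy j; apply: lt_le_trans rd.
  by apply: (le_lt_trans (ler_distD (u 0 j) _ _)); rewrite ltrD// distrC.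
move=> x [cxx [[xi Txi c1x] [zeta Tz c2z]]]; split; first exact: cubeS cxx.
by split; [exists xi => //; exact: cubeS c1x|exists zeta => //; exact: cubeS c2z].
Qed.

(** Every point with two values lies in a Lipschitz piece; shrinking that piece
    to rational centres and a radius of the form 1 / (k + 1) leaves countably
    many. *)
Lemma outer_null_multivalued h T : (0 < n)%N ->
    Ck 1 h -> h_monotone h T ->
    (forall a b, (forall j, partial j h a = partial j h b) -> a = b) ->
  outer_null [set x | dom T x /\ ~ is_singleton (T x)].
Proof.
move=> hn hC1 hT gradI.
pose K : countType :=
  ('rV[rat]_n * 'rV[rat]_n * 'rV[rat]_n * nat * 'I_n)%type.
pose rad (k : nat) : R := k.+1%:R^-1.
(* The graph condition is part of the definition of a piece, so that every
   piece is null, whatever the index. *)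
pose piece (q : K) : set 'rV[R]_n := let: (c, c1, c2, k, i) := q in
  [set x | let A := two_valued T (map_mx ratr c) (map_mx ratr c1)
             (map_mx ratr c2) (rad k) in
           A x /\ lipschitz_graph i 3 A].
apply: (@outer_null_sub _ _ _ (\bigcup_q piece q)); last first.
  apply: outer_null_bigcup => // -[[[[c c1] c2] k] i].
  apply: (@outer_null_lipschitz_graph _ _ i 3 (rad k) (map_mx ratr c)) => //.
  - by rewrite /rad invr_gt0.
  - by move=> x [[cx _] _].
  - by move=> x y [Ax G] [Ay _]; exact: G.
move=> x [[xi Txi] nsing].
have [zeta [Tzeta xizeta]] : exists zeta, T x zeta /\ zeta <> xi.
  apply: contrapT => /forallNP none; apply: nsing; exists xi.
  apply/seteqP; split => [zeta Tz|_ -> //] /=.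
  by apply: contrapT => zx; apply: (none zeta).
have [j jP] : exists j : 'I_n, partial j h (x - xi) != partial j h (x - zeta).
  apply: contrapT => /forallNP noj; apply: xizeta.
  have /addrI/oppr_inj -> // : x - xi = x - zeta.
  by apply: gradI => j; apply/eqP/negPn/negP; exact: noj.
have [i [d d0 G]] := two_valued_lipschitz_graph _ _ _ _ _ hC1 hT (ex_intro _ j jP).
have [k kd] : exists k, rad k + rad k <= d.
  exists (Num.truncn (2 / d)).
  rewrite /rad -[leLHS]mulr2n -[leLHS]mulr_natl.
  rewrite ler_pdivrMr ?ltr0Sn// mulrC -ler_pdivrMr//.
  by have /andP[_ /ltW] := truncn_itv (divr_ge0 (ler0n R 2) (ltW d0)).
have r0 : 0 < rad k by rewrite /rad invr_gt0.
have [c cx] := rational_approx x _ r0.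
have [c1 c1x] := rational_approx xi _ r0.
have [c2 c2x] := rational_approx zeta _ r0.
exists (c, c1, c2, k, i) => //=; split.
  by split => //; split; [exists xi|exists zeta].
by apply: sub_lipschitz_graph G; exact: sub_two_valued.
Qed.

End MonotoneMaps.

Theorem theorem1 (R : realType) (n : nat) (hn : (0 < n)%N)
  (p : R) (hp : 2 <= p)
  (h : 'rV[R]_n -> R)
  (h_C2 : Ck 2 h)
  (h_ge0 : forall x : 'rV[R]_n, 0 <= h x)
  (h_hom : pos_homogeneous p h)
  (h_hess : forall x : 'rV[R]_n, unit_sphere x -> pos_def (hessian h x))
  (T : 'rV[R]_n -> set 'rV[R]_n)
  (hT : h_monotone h T) :
  lebesgue_outer [set x | dom T x /\ ~ is_singleton (T x)] = 0%E.
Proof.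
have h_C1 : Ck 1 h.
  split=> [|i]; first by case: h_C2.
  by have [_ /(_ i)[dh [ch _]]] := h_C2.
apply: outer_null_lebesgue; apply: (outer_null_multivalued _ _ hn h_C1 hT).
move=> a b; apply: gradient_injective => //.
exact: hessian_pos_def h_hom h_hess.
Qed.
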